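(* Let $B$ be a unital $\mathbb K$-algebra. On $G_B^{\mathrm{inv}}$ consider the group laws $\cdot$ and $$F\star_l G:=G\cdot F\circ(IG),\quad F\star_r G:=F\circ(GI)\cdot G,\quad F\bullet G:=G\cdot F\circ(G^{-1}IG),\quad F\bullet' G:=F\circ(GIG^{-1})\cdot G ,$$ each with unit $1$. The following maps $G_B^{\mathrm{inv}}\to G_B^{\mathrm{inv}}$ are the inverse maps for the indicated group laws: $\sigma:F\mapsto F^{-1}$ for $\cdot$; $S^l:F\mapsto F^{-1}\circ(IF)^{\circ-1}$ for $\star_l$; $S^r:F\mapsto F^{-1}\circ(FI)^{\circ-1}$ for $\star_r$; $S^{\bullet}:F\mapsto F^{-1}\circ(F^{-1}IF)^{\circ-1}$ for $\bullet$; $S^{\bullet'}:F\mapsto F^{-1}\circ(FIF^{-1})^{\circ-1}$ for $\bullet'$. In particular, all these maps are involutive: $S(S(F))=F$ for $S\in\{\sigma,S^l,S^r,S^{\bullet},S^{\bullet'}\}$ and $F\in G_B^{\mathrm{inv}}$.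
   Context: $\mathbb K$ is a field of characteristic zero. For a unital $\mathbb K$-algebra $B$, $\mathrm{Mult}[[B]]$ is the set of sequences $f=(f_n)_{n\ge0}$ of $\mathbb K$-multilinear maps $f_n:B^{\otimes n}\to B$ (with $B^{\otimes 0}=\mathbb K$, so $f_0$ is identified with an element of $B$). Product: $(f\cdot g)_n(x_1,\dots,x_n)=\sum_{k=0}^n f_k(x_1,\dots,x_k)\,g_{n-k}(x_{k+1},\dots,x_n)$, also written $fg$, with unit $1=(\delta_{n,0}1)_n$. Composition, when $g_0=0$: $(f\circ g)_n(x_1,\dots,x_n)=\sum_{l\ge0}\sum_{k_1+\cdots+k_l=n,\,k_i\ge1}f_l\big(g_{k_1}(x_1,\dots,x_{k_1}),\dots,g_{k_l}(x_{n-k_l+1},\dots,x_n)\big)$, with unit $I=(\delta_{n,1}\mathrm{Id})_n$. Composition takes precedence over multiplication: $f\cdot g\circ h\cdot k=f\cdot(g\circ h)\cdot k$. $G_B^{\mathrm{inv}}=\{f: f_0\in B^\times\}$ is a group for $\cdot$, with inverse $f^{-1}$; $G_B^{\mathrm{dif}}=\{f: f_0=0,\ f_1\in \mathrm{GL}(B)\}$ is a group for $\circ$, with inverse $f^{\circ-1}$. *)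

(* Defs.v *)
From mathcomp Require Import all_boot all_algebra.
From mathcomp Require Import boolp classical_sets.

Set Implicit Arguments.
Unset Strict Implicit.
Unset Printing Implicit Defensive.

Import GRing.Theory.
Local Open Scope classical_set_scope.
Local Open Scope ring_scope.

Declare Scope mult_scope.
Delimit Scope mult_scope with M.
Reserved Notation "f ** g" (at level 40, left associativity).
Reserved Notation "f \circ g" (at level 35, no associativity).

Section Groups.
Context {T : choiceType}.
Implicit Types (G : set T) (op : T -> T -> T) (e : T) (inv : T -> T).

Record group_on G op e inv : Prop := GroupOn {
  group_on1 : G e;
  group_onM : forall x y, G x -> G y -> G (op x y);
  group_onV : forall x, G x -> G (inv x);
  group_onA : forall x y z, G x -> G y -> G z -> op x (op y z) = op (op x y) z;
  group_on1x : forall x, G x -> op e x = x;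
  group_onx1 : forall x, G x -> op x e = x;
  group_onVx : forall x, G x -> op (inv x) x = e;
  group_onxV : forall x, G x -> op x (inv x) = e }.

(* When (G, op, e) is a group, such a y exists and is unique; the default *)
(* value e is used only for x without an inverse in G.                    *)
Definition inverse_in G op e (x : T) : T :=
  xget e [set y | [/\ G y, op y x = e & op x y = e]].

End Groups.

(* A unital K-algebra is a ring B with a morphism iota from K to the center   *)
(* of B, so a acts on x as iota a * x. Unlike algType K, this allows B = 0;   *)
(* for B : algType K, take iota := GRing.in_alg B.                                  *)
Section Mult.
Context {K : fieldType} {B : pzRingType}.

(* A sequence of maps f_n : B^n -> B (n >= 0) is the same thing as one map on *)
(* lists, f_n being its restriction to the lists of size n. In particular     *)
(* f_0 is the element f [::] of B.                                            *)
Implicit Types f g : seq B -> B.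

Definition Mult (iota : {rmorphism K -> B}) : set (seq B -> B) :=
  [set f | forall (s t : seq B) (a : K) (x y : B),
     f (s ++ (iota a * x + y) :: t)
       = iota a * f (s ++ x :: t) + f (s ++ y :: t)].

Definition mult_mul f g : seq B -> B :=
  fun x => \sum_(k < (size x).+1) f (take k x) * g (drop k x).

Definition mult_one : seq B -> B := fun x => if x is [::] then 1 else 0.

(* With n = size x, the inner sum runs over the k = (k_1, ..., k_l) with      *)
(* k_i >= 1 and k_1 + ... + k_l = n (hence l <= n and every k_i <= n).        *)
Definition mult_comp f g : seq B -> B :=
  fun x => \sum_(l < (size x).+1)
    \sum_(k : l.-tuple 'I_(size x).+1 |
            all (fun i : 'I__ => 0 < i)%N k && (\sum_(i <- k) i == size x)%N)
      f [seq g b | b <- reshape [seq val i | i <- k] x].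

Definition mult_id : seq B -> B := fun x => if x is [:: b] then b else 0.

Definition Ginv (iota : {rmorphism K -> B}) : set (seq B -> B) :=
  [set f | Mult iota f /\ exists c : B, c * f [::] = 1 /\ f [::] * c = 1].

Definition Gdif (iota : {rmorphism K -> B}) : set (seq B -> B) :=
  [set f | [/\ Mult iota f, f [::] = 0 & bijective (fun b : B => f [:: b])]].

Local Notation "f ** g" := (mult_mul f g) : mult_scope.
Local Notation "f \circ g" := (mult_comp f g) : mult_scope.
Local Notation I := mult_id.
Local Open Scope mult_scope.

Definition lstar (F G : seq B -> B) := G ** F \circ (I ** G).
Definition rstar (F G : seq B -> B) := F \circ (G ** I) ** G.

Section Inverses.
Variable iota : {rmorphism K -> B}.

Definition mult_inv : (seq B -> B) -> (seq B -> B) :=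
  inverse_in (Ginv iota) mult_mul mult_one.

Definition comp_inv : (seq B -> B) -> (seq B -> B) :=
  inverse_in (Gdif iota) mult_comp mult_id.

Local Notation "f ^-1" := (mult_inv f) : mult_scope.

Definition bullet (F G : seq B -> B) := G ** F \circ (G^-1 ** I ** G).
Definition bullet' (F G : seq B -> B) := F \circ (G ** I ** G^-1) ** G.

Definition sigma (F : seq B -> B) := F^-1.
Definition S_lstar (F : seq B -> B) := F^-1 \circ comp_inv (I ** F).
Definition S_rstar (F : seq B -> B) := F^-1 \circ comp_inv (F ** I).
Definition S_bullet (F : seq B -> B) := F^-1 \circ comp_inv (F^-1 ** I ** F).
Definition S_bullet' (F : seq B -> B) := F^-1 \circ comp_inv (F ** I ** F^-1).

End Inverses.
End Mult.

(* Main.v *)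
Require Import Defs.
From mathcomp Require Import all_boot all_algebra.
From mathcomp Require Import boolp classical_sets.

(** Every law of the statement other than the product itself sends [(x, y)] to
    [y (x o phi y)], or to the same product with its factors exchanged,
    where [phi] sends an invertible sequence to a composition-invertible one:
    [phi G] is [I G], [G I], [G^-1 I G] or [G I G^-1].  Composition on the right acts on the
    multiplicative group by automorphisms, because
    [(f g) o h = (f o h) (g o h)] ([comp_mul]) and composition is associative
    ([comp_assoc]).  In each case this distributivity gives
    [phi F o phi H = phi (F * H)], where [F * H] is the new law; equivalently,
    the graph of [phi] is a subgroup of a semidirect product, and the new law is
    the law of that graph read off on its first coordinate.  The group axioms
    and the formula [F^-1 o (phi F)^(o -1)] for the inverse follow formally
    ([group_on_twist]), and inverse maps are involutive in any group
    ([group_invK]).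

    What remains is that the two basic laws are group laws.  Both are sums over
    ways of cutting the list of arguments: in two for the product ([cuts]), in
    nonempty blocks for the composition ([segs]).  Peeling off the first block
    gives a recursion for composition ([comp_cons]), and all the algebra reduces
    to it and to the coassociativity of cutting in two ([big_cuts_coassoc]).

    Inverses come from two series that are finite on each list of arguments.
    For the product, normalise [f] to [c f = 1 - h] with zero constant term in
    [h]; the geometric series of [h] is the composition with [h] of the sequence
    of iterated products, which is why it is multilinear.  For composition,
    normalise [f] to have linear part the identity; then [q |-> q o f - q]
    strictly increases the degree, so [q |-> q o f] is inverted by successive
    approximation, and the preimage of [I] is a left inverse of [f]. *)

Set Implicit Arguments.
Unset Strict Implicit.
Unset Printing Implicit Defensive.

Import GRing.Theory.
Local Open Scope classical_set_scope.
Local Open Scope ring_scope.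
Local Open Scope mult_scope.

Local Notation "f ** g" := (mult_mul f g) : mult_scope.
Local Notation "f \circ g" := (mult_comp f g) : mult_scope.
Local Notation I := mult_id.

(** * Groups on subsets, and twisting a group by an action *)

Section AbstractGroups.
Context {T : choiceType}.
Implicit Types (G D : set T) (op : T -> T -> T) (e : T) (inv : T -> T).

Lemma group_on_left_inverse G op e inv :
  G e -> (forall x y, G x -> G y -> G (op x y)) -> (forall x, G x -> G (inv x)) ->
  (forall x y z, G x -> G y -> G z -> op x (op y z) = op (op x y) z) ->
  (forall x, G x -> op e x = x) -> (forall x, G x -> op x e = x) ->
  (forall x, G x -> op (inv x) x = e) -> group_on G op e inv.
Proof.
move=> G1 GM GV A e1 e2 Vx; split=> // x Gx.
have Gy := GV _ Gx; have Gz := GV _ Gy.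
suff -> : op x (inv x) = op (inv (inv x)) (inv x) by exact: Vx.
by rewrite -{1}(e1 x Gx) -(Vx _ Gy) -(A (inv (inv x))) // Vx // e2.
Qed.

(** Left inverses suffice: [inverse_in] asks for a two-sided one, and in a monoid
    where every element has a left inverse these are two-sided. *)
Lemma group_on_inverse_in G op e :
  G e -> (forall x y, G x -> G y -> G (op x y)) ->
  (forall x y z, G x -> G y -> G z -> op x (op y z) = op (op x y) z) ->
  (forall x, G x -> op e x = x) -> (forall x, G x -> op x e = x) ->
  (forall x, G x -> exists2 y, G y & op y x = e) ->
  group_on G op e (inverse_in G op e).
Proof.
move=> G1 GM A e1 e2 exV.
pose inv x := xget e [set y | G y /\ op y x = e].
have invP x : G x -> G (inv x) /\ op (inv x) x = e.
  move=> /exV[y Gy yx].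
  by apply: (@xgetPex _ e [set z | G z /\ op z x = e]); exists y.
have gG : group_on G op e inv.
  by apply: group_on_left_inverse => // x /invP[].
have iP x : G x -> [/\ G (inverse_in G op e x), op (inverse_in G op e x) x = e
    & op x (inverse_in G op e x) = e].
  move=> Gx.
  apply: (@xgetPex _ e [set y | [/\ G y, op y x = e & op x y = e]]); exists (inv x).
  by split; [apply: (group_onV gG)|apply: (group_onVx gG)|apply: (group_onxV gG)].
by split=> // x /iP[].
Qed.

Lemma group_on_flip G op e inv :
  group_on G op e inv -> group_on G (fun x y => op y x) e inv.
Proof. by case=> G1 GM GV A e1 e2 Vx xV; split=> // *; rewrite ?A //; apply: GM. Qed.

Lemma group_inv_uniq G op e inv : group_on G op e inv ->
  forall x y, G x -> G y -> op y x = e -> y = inv x.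
Proof.
move=> gG x y Gx Gy yx; have GV := group_onV gG Gx.
by rewrite -(group_onx1 gG Gy) -(group_onxV gG Gx) (group_onA gG) // yx (group_on1x gG).
Qed.

Lemma group_invK G op e inv : group_on G op e inv -> {in G, involutive inv}.
Proof.
move=> gG x; rewrite inE => Gx; have GV := group_onV gG Gx.
by apply/esym/(group_inv_uniq gG) => //; apply: (group_onxV gG).
Qed.

Lemma group_inv_op G op e inv : group_on G op e inv ->
  forall x y, G x -> G y -> inv (op x y) = op (inv y) (inv x).
Proof.
move=> gG x y Gx Gy; have [Vx Vy] := (group_onV gG Gx, group_onV gG Gy).
have GM := group_onM gG.
apply/esym/(group_inv_uniq gG); [exact: GM | exact: GM |].
rewrite (group_onA gG) //; last exact: GM.
by rewrite -[op (op _ _) x](group_onA gG) // (group_onVx gG) // (group_onx1 gG) //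
  (group_onVx gG).
Qed.

(** The pairs [(F, phi F)] are closed under the law
    [(F, p) (H, q) = (H . (F o q), p o q)] of the semidirect product, by the
    last hypothesis on [phi]; the twisted law is this law on first
    coordinates. *)
Lemma group_on_twist G dot e inv D comp i cinv (phi : T -> T) :
  group_on G dot e inv -> group_on D comp i cinv ->
  (forall F p, G F -> D p -> G (comp F p)) ->
  (forall F H p, G F -> G H -> D p ->
     comp (dot F H) p = dot (comp F p) (comp H p)) ->
  (forall p, D p -> comp e p = e) ->
  (forall F p q, G F -> D p -> D q -> comp F (comp p q) = comp (comp F p) q) ->
  (forall F, G F -> comp F i = F) ->
  (forall F, G F -> D (phi F)) ->
  phi e = i ->
  (forall F H, G F -> G H ->
     comp (phi F) (phi H) = phi (dot H (comp F (phi H)))) ->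
  group_on G (fun F H => dot H (comp F (phi H))) e
    (fun F => comp (inv F) (cinv (phi F))).
Proof.
move=> gG gD Gact actM act1 actA acti phiD phi1 phiM.
have GM := group_onM gG; have GV := group_onV gG; have DV := group_onV gD.
apply: group_on_left_inverse => [|F H GF GH|F GF|F H L GF GH GL|F GF|F GF|F GF].
- exact: (group_on1 gG).
- by apply: (GM) => //; apply: Gact => //; apply: phiD.
- by apply: Gact; [exact: GV | apply/DV/phiD].
- have [pH pL] := (phiD _ GH, phiD _ GL).
  have [HL FH] := (Gact _ _ GH pL, Gact _ _ GF pH).
  by rewrite -phiM // actM // actA // (group_onA gG) //; apply: Gact.
- by rewrite act1 ?(group_onx1 gG) //; apply: phiD.
- by rewrite phi1 acti // (group_on1x gG).
- have pF := phiD _ GF; have qF := DV _ pF; have VF := GV _ GF.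
  by rewrite -actA // (group_onVx gD) // acti // (group_onxV gG).
Qed.

End AbstractGroups.

(** * Cutting a list *)

Section Cuts.
Context {A : Type}.
Implicit Types (x y : seq A) (p : seq (seq A)).

Fixpoint cuts x : seq (seq A * seq A) :=
  if x is b :: y then ([::], x) :: [seq (b :: w.1, w.2) | w <- cuts y]
  else [:: ([::], [::])].

Definition glue b p := if p is c :: p' then (b :: c) :: p' else p.

(** The ways to cut [x] into consecutive nonempty blocks: the head of the list
    is either a block by itself, or is put in front of the first block of a
    cutting of the tail. *)
Fixpoint segs x : seq (seq (seq A)) :=
  if x is b :: y then
    [seq [:: b] :: p | p <- segs y] ++ [seq glue b p | p <- segs y & ~~ nilp p]
  else [:: [::]].

Lemma segs_consE b x : segs (b :: x) =
  [seq [:: b] :: p | p <- segs x] ++ [seq glue b p | p <- segs x & ~~ nilp p].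
Proof. by []. Qed.

Variable V : nmodType.
Implicit Types (m : seq A -> seq A -> V).

Lemma big_cuts_cons b x m : \sum_(w <- cuts (b :: x)) m w.1 w.2 =
  m [::] (b :: x) + \sum_(w <- cuts x) m (b :: w.1) w.2.
Proof. by rewrite big_cons big_map. Qed.

Lemma big_cuts_cat b s t m : \sum_(w <- cuts (s ++ b :: t)) m w.1 w.2 =
  \sum_(w <- cuts s) m w.1 (w.2 ++ b :: t)
  + \sum_(w <- cuts t) m (s ++ b :: w.1) w.2.
Proof.
elim: s m => [|c s IHs] m; first by rewrite cat0s big_cuts_cons big_seq1.
rewrite cat_cons big_cuts_cons (IHs (fun u => m (c :: u))) addrA.
by rewrite (big_cuts_cons c s (fun u v => m u (v ++ b :: t))).
Qed.

(** Both sides sum over the ways to cut [x] in three; this carries the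
    associativity of the product and of composition. *)
Lemma big_cuts_coassoc (F : seq A -> seq A -> seq A -> V) x :
  \sum_(w <- cuts x) \sum_(c <- cuts w.2) F w.1 c.1 c.2 =
  \sum_(w <- cuts x) \sum_(c <- cuts w.1) F c.1 c.2 w.2.
Proof.
elim: x F => [|b x IHx] F; first by rewrite !big_seq1.
rewrite (big_cuts_cons b x (fun u v => \sum_(c <- cuts v) F u c.1 c.2)).
rewrite (big_cuts_cons b x (fun u v => \sum_(c <- cuts u) F c.1 c.2 v)).
rewrite big_cuts_cons big_seq1 -addrA (IHx (fun u => F (b :: u))) -big_split /=.
congr (_ + _); apply: eq_bigr => w _.
by rewrite (big_cuts_cons _ _ (fun u v => F u v w.2)).
Qed.

Lemma big_ord_cuts m x :
  \sum_(k < (size x).+1) m (take k x) (drop k x) = \sum_(w <- cuts x) m w.1 w.2.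
Proof.
elim: x m => [|b x IHx] m; first by rewrite big_ord_recl big_ord0 big_seq1 addr0.
by rewrite big_cuts_cons -(IHx (fun u => m (b :: u))) big_ord_recl.
Qed.

Lemma big_segs_glue b x (M : seq (seq A) -> V) : \sum_(p <- segs (b :: x)) M p =
  \sum_(p <- segs x) M ([:: b] :: p)
  + \sum_(p <- segs x) if nilp p then 0 else M (glue b p).
Proof.
rewrite segs_consE big_cat !big_map big_filter; congr (_ + _).
by rewrite [LHS]big_mkcond; apply: eq_bigr => p _; case: (nilp p).
Qed.

(** Sorts the cuttings by their first block, which [segs] itself builds one
    element at a time. *)
Lemma big_segs_cons b x (M : seq (seq A) -> V) : \sum_(p <- segs (b :: x)) M p =
  \sum_(w <- cuts x) \sum_(p <- segs w.2) M ((b :: w.1) :: p).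
Proof.
elim: x b M => [|a y IHy] b M; first by rewrite /= !big_seq1.
rewrite big_segs_glue (IHy a (fun p => if nilp p then 0 else M (glue b p))).
by rewrite (big_cuts_cons _ _ (fun u v => \sum_(p <- segs v) M ((b :: u) :: p))).
Qed.

End Cuts.

Lemma size_cuts (A : eqType) (x : seq A) w : w \in cuts x ->
  (size w.2 <= size x)%N.
Proof.
elim: x w => [|b x IHx] w /=; first by rewrite inE => /eqP ->.
by rewrite inE => /predU1P[-> //|/mapP[c /IHx cx ->]]; apply: leq_trans cx _.
Qed.

Lemma mem_segs (A : eqType) (x : seq A) p :
  (p \in segs x) = (flatten p == x) && ([::] \notin p).
Proof.
elim: x p => [|b x IHx] p.
  rewrite mem_seq1; case: p => [|[|a c] p] //=.
  by rewrite andbF.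
rewrite segs_consE mem_cat; apply/orP/idP => [[/mapP|/mapP]|].
- by move=> [q]; rewrite IHx => /andP[/eqP <- nq] ->; rewrite /= eqxx inE.
- move=> [[|c q]]; rewrite mem_filter //= IHx inE negb_or.
  by move=> /and3P[/eqP <- _ nq] ->; rewrite /= eqxx inE.
- case: p => [|[|a [|c u]] p]; rewrite // inE negb_or /=.
  - by rewrite andbF.
  - move=> /andP[/eqP[-> pE] np]; left; apply/mapP; exists p => //.
    by rewrite IHx pE eqxx.
  - move=> /andP[/eqP[-> pE] np]; right; apply/mapP; exists ((c :: u) :: p) => //.
    by rewrite mem_filter IHx -pE /= eqxx inE.
Qed.

Lemma segs_uniq (A : eqType) (x : seq A) : uniq (segs x).
Proof.
elim: x => [//|b x IHx]; rewrite segs_consE cat_uniq; apply/and3P; split.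
- by rewrite map_inj_uniq // => p q [].
- apply/hasPn => q /mapP[[|c p]]; rewrite mem_filter //= mem_segs.
  move=> /andP[_]; rewrite inE negb_or => /andP[nc _] ->.
  by apply/mapP => -[r _ [c0 _]]; rewrite c0 in nc.
- rewrite map_inj_in_uniq ?filter_uniq // => p q.
  rewrite !mem_filter; case: p q => [|c p] [|d q] //= _ _ [-> ->] //.
Qed.

Lemma segs_le_size (A : eqType) (x : seq A) p : p \in segs x -> (size p <= size x)%N.
Proof.
rewrite mem_segs => /andP[/eqP <- np]; rewrite size_flatten.
elim: p np => [//|c p IHp] /=; rewrite inE negb_or => /andP[nc /IHp].
by case: c nc => //= a c _ le; rewrite addSn ltnS (leq_trans le) // leq_addl.
Qed.

(** * Product and composition as sums over cuttings *)

Section MultSums.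
Context {B : pzRingType}.
Implicit Types (f g h : seq B -> B) (x s t : seq B).

Lemma mult_mulE f g x : (f ** g) x = \sum_(w <- cuts x) f w.1 * g w.2.
Proof. by rewrite -(big_ord_cuts (fun u v => f u * g v)). Qed.

(** A cutting into nonempty blocks is determined by the sizes of its blocks, so
    [reshape] and [shape] match the tuples of the definition of composition with
    the cuttings of [segs]. *)
Lemma mult_compE f g x : (f \circ g) x = \sum_(p <- segs x) f (map g p).
Proof.
rewrite /mult_comp.
pose n := (size x).+1.
pose blocks l (k : l.-tuple 'I_n) := reshape [seq val i | i <- k] x.
pose P := [seq blocks l k | l : 'I_n <- enum 'I_n,
  k <- [seq k : l.-tuple 'I_n <- enum {: l.-tuple 'I_n} |
     all (fun i : 'I_n => 0 < i)%N k && (\sum_(i <- k) i == size x)%N]].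
have sumE l (k : l.-tuple 'I_n) : (\sum_(i <- k) i)%N = sumn (map val k).
  by rewrite sumnE big_map.
have shapeE l (k : l.-tuple 'I_n) :
    (\sum_(i <- k) i == size x)%N -> shape (blocks l k) = map val k.
  by rewrite sumE => /eqP kx; rewrite /blocks reshapeKl // kx.
suff perm_P : perm_eq P (segs x).
  rewrite -(perm_big _ perm_P) big_allpairs_dep big_enum /=.
  by apply: eq_bigr => l _; rewrite big_filter big_enum_cond.
apply: uniq_perm; [|exact: segs_uniq|] => [|p].
  apply: allpairs_uniq_dep => [|l _|]; first exact: enum_uniq.
    exact/filter_uniq/enum_uniq.
  move=> _ _ /allpairsPdep[l1 [k1 [_ + ->]]] /allpairsPdep[l2 [k2 [_ + ->]]].
  rewrite !mem_filter => /andP[/andP[_ c1] _] /andP[/andP[_ c2] _] /=.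
  move=> /(congr1 shape); rewrite !shapeE // => /(inj_map val_inj) k12.
  have l12 : l1 = l2 by apply: val_inj; rewrite /= -(size_tuple k1) k12 size_tuple.
  by case: _ / l12 in k2 c2 k12 *; congr (Tagged _ _); apply: val_inj.
rewrite mem_segs; apply/allpairsPdep/andP => [[l [k [_]]]|[/eqP px np]].
  rewrite mem_filter => /andP[/andP[k_gt0 kx] _] ->; split.
    by rewrite reshapeKr // -sumE (eqP kx).
  apply/negP => /(map_f size); rewrite -/(shape _) shapeE //.
  by move=> /mapP[i /(allP k_gt0) + i0]; rewrite -[i : nat]/(val i) -i0.
have sx : sumn (shape p) = size x by rewrite -size_flatten px.
have lt_n i : i \in shape p -> (i < n)%N.
  by move=> ip; rewrite ltnS -sx sumnE (big_rem i ip) leq_addr.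
have ltp : (size p < n)%N.
  by rewrite ltnS; apply: segs_le_size; rewrite mem_segs px eqxx.
have kP : size [seq inord i : 'I_n | i <- shape p] == Ordinal ltp by rewrite !size_map.
have kE : map val (Tuple kP) = shape p.
  by rewrite -map_comp map_id_in // => i ip; rewrite /= inordK // lt_n.
exists (Ordinal ltp), (Tuple kP); split; rewrite ?mem_enum //; last first.
  by rewrite /blocks kE -px flattenK.
rewrite mem_filter mem_enum andbT sumE kE sx eqxx andbT.
rewrite -(all_map val (ltn 0)) kE; apply/allP => _ /mapP[c cp ->].
by case: c cp np => // ->.
Qed.

Lemma comp_nil f g : (f \circ g) [::] = f [::].
Proof. by rewrite mult_compE big_seq1. Qed.

(** The recursion behind all the inductions on composition: the first block
    becomes the first argument of [f], which is then a new sequence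
    [fun t => f (g (b :: w.1) :: t)] in the remaining arguments. *)
Lemma comp_cons f g b x : (f \circ g) (b :: x) =
  \sum_(w <- cuts x) mult_comp (fun t => f (g (b :: w.1) :: t)) g w.2.
Proof.
rewrite mult_compE big_segs_cons.
by apply: eq_bigr => w _; rewrite mult_compE.
Qed.

Lemma comp_singleton f g b : (f \circ g) [:: b] = f [:: g [:: b]].
Proof. by rewrite comp_cons big_seq1 comp_nil. Qed.

Lemma eq_comp_size f f' g x :
  (forall t, (size t <= size x)%N -> f t = f' t) -> (f \circ g) x = (f' \circ g) x.
Proof.
move=> ff'; rewrite !mult_compE; apply: eq_big_seq => p /segs_le_size px.
by rewrite ff' ?size_map.
Qed.

Lemma comp_sum (J : Type) (r : seq J) (F : J -> seq B -> B) g x :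
  mult_comp (fun t => \sum_(j <- r) F j t) g x = \sum_(j <- r) (F j \circ g) x.
Proof.
rewrite mult_compE exchange_big /=.
by apply: eq_bigr => j _; rewrite mult_compE.
Qed.

(** Cutting [x] in blocks and the sequence of blocks in two is the same as
    cutting [x] in two and each part in blocks.  The induction peels off the
    first block of [x]; [m [::]] accounts for the cut before it. *)
Lemma comp_cut_sum (m : seq B -> seq B -> B) h x :
  mult_comp (fun t => \sum_(d <- cuts t) m d.1 d.2) h x =
  \sum_(c <- cuts x)
    mult_comp (fun u => mult_comp (fun v => m u v) h c.2) h c.1.
Proof.
have [n] := ubnP (size x); elim: n x m => // n IHn [|b x] m xn.
  by rewrite comp_nil !big_seq1 !comp_nil.
rewrite comp_cons (big_cuts_cons b x
  (fun y z => mult_comp (fun u => mult_comp (fun v => m u v) h z) h y)).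
rewrite comp_nil comp_cons.
under eq_big_seq => w wx.
  (* Composition is additive in its left argument; the sum of the two kinds of
     cuts is written as a sum over booleans so that [comp_sum] applies. *)
  rewrite (@eq_comp_size _ (fun t => \sum_(j <- [:: true; false])
    if j then m [::] (h (b :: w.1) :: t)
    else \sum_(d <- cuts t) m (h (b :: w.1) :: d.1) d.2)); last first.
    by move=> t _; rewrite big_cuts_cons big_cons big_seq1.
  rewrite comp_sum big_cons big_seq1 /=.
  rewrite (IHn _ (fun u => m (h (b :: w.1) :: u))); last first.
    exact: leq_ltn_trans (size_cuts wx) xn.
  over.
rewrite big_split /=; congr (_ + _).
rewrite (big_cuts_coassoc (fun u y z =>
  mult_comp (fun s => mult_comp (fun v => m (h (b :: u) :: s) v) h z) h y)).
by apply: eq_bigr => w _; rewrite comp_cons.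
Qed.

Lemma comp_mul f g h : (f ** g) \circ h = (f \circ h) ** (g \circ h).
Proof.
apply/funext => x; rewrite mult_mulE.
rewrite (@eq_comp_size _ (fun t => \sum_(d <- cuts t) f d.1 * g d.2)); last first.
  by move=> t _; rewrite mult_mulE.
rewrite (comp_cut_sum (fun u v => f u * g v)); apply: eq_bigr => c _.
rewrite !mult_compE big_distrlr /=; apply: eq_bigr => p _.
by rewrite mult_compE.
Qed.

Lemma comp_one h : mult_one \circ h = mult_one.
Proof.
apply/funext => -[|b x]; first by rewrite comp_nil.
rewrite comp_cons big1 // => w _.
by rewrite mult_compE big1.
Qed.

Lemma mul_assoc f g h : f ** (g ** h) = (f ** g) ** h.
Proof.
apply/funext => x; rewrite !mult_mulE.
under eq_bigr => w _ do rewrite mult_mulE mulr_sumr.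
rewrite (big_cuts_coassoc (fun u y z => f u * (g y * h z))).
apply: eq_bigr => w _; rewrite mult_mulE mulr_suml.
by apply: eq_bigr => c _; rewrite mulrA.
Qed.

Lemma mul_one_l f : mult_one ** f = f.
Proof.
apply/funext => -[|b x]; rewrite mult_mulE ?big_seq1 ?mul1r //.
rewrite (big_cuts_cons b x (fun u v => mult_one u * f v)) mul1r big1 ?addr0 //.
by move=> w _; rewrite mul0r.
Qed.

Lemma mul_one_r f : f ** mult_one = f.
Proof.
apply/funext => x; rewrite mult_mulE; elim: x f => [|b x IHx] f.
  by rewrite big_seq1 mulr1.
rewrite (big_cuts_cons b x (fun u v => f u * mult_one v)) mulr0 add0r.
exact: IHx (fun u => f (b :: u)).
Qed.

Lemma mul_nil f g : (f ** g) [::] = f [::] * g [::].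
Proof. by rewrite mult_mulE big_seq1. Qed.

Lemma mul_singleton f g b :
  (f ** g) [:: b] = f [::] * g [:: b] + f [:: b] * g [::].
Proof.
by rewrite mult_mulE (big_cuts_cons b [::] (fun u v => f u * g v)) big_seq1.
Qed.

(** With [I] on the left only the cutting in one block survives; in the recursion
    this is the product by [mult_one] of the sequence [g] without its first
    argument. *)
Lemma comp_id_l g : g [::] = 0 -> I \circ g = g.
Proof.
move=> g0; apply/funext => -[|b x]; first by rewrite comp_nil g0.
transitivity (((fun u => g (b :: u)) ** mult_one) x); last by rewrite mul_one_r.
rewrite mult_mulE comp_cons.
apply: eq_bigr => w _; case: w.2 => [|c v].
  by rewrite comp_nil mulr1.
rewrite comp_cons big1 ?mulr0 // => d _.
by rewrite mult_compE big1.
Qed.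

End MultSums.

(** * Multilinear sequences *)

Section Multilinear.
Context {K : fieldType} {B : pzRingType} {iota : {rmorphism K -> B}}.
Hypothesis iota_central : forall (a : K) (x : B), iota a * x = x * iota a.
Implicit Types (f g h : seq B -> B) (x s t : seq B).

Lemma Mult_add f s t b c : Mult iota f ->
  f (s ++ (b + c) :: t) = f (s ++ b :: t) + f (s ++ c :: t).
Proof. by move=> Mf; have := Mf s t 1 b c; rewrite rmorph1 !mul1r. Qed.

Lemma Mult_zero f s t : Mult iota f -> f (s ++ 0 :: t) = 0.
Proof.
by move=> Mf; apply: (@addrI _ (f (s ++ 0 :: t))); rewrite -Mult_add // !addr0.
Qed.

Lemma Mult_sum f s t (J : Type) (r : seq J) (F : J -> B) : Mult iota f ->
  f (s ++ (\sum_(j <- r) F j) :: t) = \sum_(j <- r) f (s ++ F j :: t).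
Proof.
move=> Mf; apply: (big_morph (fun b => f (s ++ b :: t))) => [b c|].
  exact: Mult_add.
exact: Mult_zero.
Qed.

Lemma Mult_cons f b : Mult iota f -> Mult iota (fun t => f (b :: t)).
Proof. by move=> Mf s t a y z; rewrite -!cat_cons Mf. Qed.

Lemma Mult_one : Mult iota mult_one.
Proof. by case=> [|c s] t a y z; rewrite /= mulr0 addr0. Qed.

Lemma Mult_head (F : B -> B) :
  (forall a b c, F (iota a * b + c) = iota a * F b + F c) ->
  Mult iota (fun t => if t is [:: b] then F b else 0).
Proof.
move=> linF [|d [|e s]] [|u t] a y z; rewrite /= ?mulr0 ?addr0 //; exact: linF.
Qed.

Lemma Mult_id : Mult iota I.
Proof. exact: (@Mult_head id). Qed.

Lemma Mult_prod : Mult iota (fun t => \prod_(b <- t) b).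
Proof.
move=> s t a y z; rewrite !big_cat !big_cons /= mulrDl mulrDr; congr (_ + _).
by rewrite !mulrA iota_central.
Qed.

Lemma Mult_lin (a : K) f g : Mult iota f -> Mult iota g ->
  Mult iota (fun t => iota a * f t + g t).
Proof.
move=> Mf Mg s t c y z; rewrite Mf Mg !mulrDr addrACA; congr (_ + _ + _).
by rewrite !mulrA -!rmorphM mulrC.
Qed.

Lemma Mult_mull c f : Mult iota f -> Mult iota (fun t => c * f t).
Proof. by move=> Mf s t a y z; rewrite Mf mulrDr !mulrA iota_central. Qed.

Lemma Mult_mulr c f : Mult iota f -> Mult iota (fun t => f t * c).
Proof. by move=> Mf s t a y z; rewrite Mf mulrDl !mulrA. Qed.

Lemma Mult_mul f g : Mult iota f -> Mult iota g -> Mult iota (f ** g).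
Proof.
move=> Mf Mg s t a y z; rewrite !mult_mulE !(big_cuts_cat _ _ _ (fun u v => f u * g v)).
rewrite mulrDr !mulr_sumr addrACA -!big_split.
congr (_ + _); apply: eq_bigr => w _ /=.
  by rewrite Mg mulrDr !mulrA iota_central.
by rewrite Mf mulrDl !mulrA.
Qed.

(** The argument in position [size s] falls either in the first block, where
    both [g] and the first argument of [f] are linear, or after it, where
    induction applies to [f] with its first argument fixed. *)
Lemma Mult_comp f g : Mult iota f -> Mult iota g -> Mult iota (f \circ g).
Proof.
move=> Mf Mg s; have [n] := ubnP (size s); elim: n s f Mf => // n IHn [|c s] f Mf sn t a y z.
  rewrite /= !comp_cons mulr_sumr -big_split; apply: eq_bigr => w _ /=.
  rewrite !mult_compE mulr_sumr -big_split; apply: eq_bigr => p _ /=.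
  by rewrite (Mg [::]) (Mf [::]).
rewrite /= !comp_cons.
rewrite !(big_cuts_cat _ _ _
  (fun u v => mult_comp (fun t => f (g (c :: u) :: t)) g v)).
rewrite mulrDr !mulr_sumr addrACA -!big_split; congr (_ + _).
  apply: eq_big_seq => w ws /=; apply: IHn; first exact: Mult_cons.
  exact: leq_ltn_trans (size_cuts ws) _.
apply: eq_bigr => w _ /=.
rewrite !mult_compE mulr_sumr -big_split; apply: eq_bigr => p _ /=.
by rewrite -!cat_cons Mg (Mf [::]).
Qed.

(** After peeling off blocks, both sides are sums over a first block
    [b :: c.1] for [h], further blocks [p] grouped with it by [g], and the
    rest.  Multilinearity of [f] is what allows the sum [(g \circ h) (b :: _)]
    to be taken out of its first argument. *)
Lemma comp_assoc f g h : Mult iota f -> f \circ (g \circ h) = (f \circ g) \circ h.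
Proof.
move=> Mf; apply/funext => x; have [n] := ubnP (size x).
elim: n x f Mf => // n IHn [|b x] f Mf xn; first by rewrite !comp_nil.
rewrite !comp_cons.
transitivity (\sum_(w <- cuts x) \sum_(c <- cuts w.1) \sum_(p <- segs c.2)
  mult_comp (mult_comp (fun t => f (g (h (b :: c.1) :: map h p) :: t)) g) h w.2).
  apply: eq_big_seq => w ws; rewrite IHn; first last.
  - exact: leq_ltn_trans (size_cuts ws) _.
  - exact: Mult_cons.
  transitivity (mult_comp (fun t => \sum_(c <- cuts w.1) \sum_(p <- segs c.2)
      mult_comp (fun t => f (g (h (b :: c.1) :: map h p) :: t)) g t) h w.2).
    apply: eq_comp_size => t _; rewrite comp_cons.
    transitivity (mult_comp (fun s => \sum_(c <- cuts w.1) \sum_(p <- segs c.2)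
        f (g (h (b :: c.1) :: map h p) :: s)) g t); last first.
      by rewrite comp_sum; apply: eq_bigr => c _; rewrite comp_sum.
    apply: eq_comp_size => u _.
    rewrite (Mult_sum [::]) //; apply: eq_bigr => c _.
    by rewrite mult_compE (Mult_sum [::]).
  by rewrite comp_sum; apply: eq_bigr => c _; rewrite comp_sum.
rewrite -(big_cuts_coassoc (fun u y z => \sum_(p <- segs y)
  mult_comp (mult_comp (fun t => f (g (h (b :: u) :: map h p) :: t)) g) h z)).
apply: eq_bigr => w _.
transitivity (mult_comp (fun t => \sum_(d <- cuts t)
    mult_comp (fun s => f (g (h (b :: w.1) :: d.1) :: s)) g d.2) h w.2).
  rewrite (comp_cut_sum (fun u v =>
    mult_comp (fun s => f (g (h (b :: w.1) :: u) :: s)) g v)).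
  by apply: eq_bigr => c _; rewrite mult_compE.
by apply: eq_comp_size => t _; rewrite comp_cons.
Qed.

Lemma comp_id_r f : Mult iota f -> f \circ I = f.
Proof.
move=> Mf; apply/funext => x; elim: x f Mf => [|b x IHx] f Mf.
  by rewrite comp_nil.
rewrite comp_cons; case: x IHx => [|c x] IHx.
  by rewrite big_seq1 comp_nil.
rewrite (big_cuts_cons c x (fun u v => mult_comp (fun t => f (I (b :: u) :: t)) I v)).
rewrite big1 ?addr0 => [|w _]; first exact: IHx (Mult_cons b Mf).
by rewrite mult_compE big1 // => p _; apply: (@Mult_zero _ [::]).
Qed.

(** * The multiplicative group *)

(** [q] is the geometric series of [h = 1 - c f], where [c] inverts the constant
    term of [f]; its recursion [q (b :: x) = sum h (b :: u) q v] over the cuts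
    [(u, v)] of [x] says that [(1 - h) q = 1]. *)
Lemma mul_right_inverse f : Ginv iota f -> exists2 g, Ginv iota g & f ** g = mult_one.
Proof.
move=> [Mf [c [cf fc]]].
pose h := fun t => mult_one t - c * f t.
pose q := mult_comp (fun t => \prod_(b <- t) b) h.
have Mh : Mult iota h.
  have -> : h = fun t => iota (-1) * (c * f t) + mult_one t.
    by apply/funext => t; rewrite rmorphN1 mulN1r addrC.
  by apply: Mult_lin; [exact: Mult_mull|exact: Mult_one].
have Mq : Mult iota q by apply: Mult_comp => //; exact: Mult_prod.
have q0 : q [::] = 1 by rewrite /q comp_nil big_nil.
exists (fun t => q t * c).
  split; first exact: Mult_mulr.
  by exists (f [::]); rewrite q0 mul1r.
apply/funext => x; rewrite mult_mulE.
case: x => [|b x]; first by rewrite big_seq1 q0 mul1r.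
rewrite (big_cuts_cons b x (fun u v => f u * (q v * c))).
have -> : q (b :: x) = - \sum_(w <- cuts x) c * f (b :: w.1) * q w.2.
  rewrite /q comp_cons -sumrN; apply: eq_bigr => w _.
  rewrite !mult_compE -mulNr mulr_sumr; apply: eq_bigr => p _.
  by rewrite big_cons /h sub0r.
rewrite mulNr mulrN mulr_suml mulr_sumr -sumrN -big_split big1 // => w _.
by rewrite /= !mulrA fc mul1r addNr.
Qed.

Lemma group_mul : group_on (Ginv iota) mult_mul mult_one (mult_inv iota).
Proof.
have GM f g : Ginv iota f -> Ginv iota g -> Ginv iota (f ** g).
  move=> [Mf [c [cf fc]]] [Mg [d [dg gd]]]; split; first exact: Mult_mul.
  exists (d * c); rewrite mul_nil; split.
    by rewrite mulrA -(mulrA d) cf mulr1.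
  by rewrite mulrA -(mulrA (f [::])) gd mulr1.
apply: group_on_inverse_in => //.
- by split; [exact: Mult_one | exists 1; rewrite mulr1].
- by move=> *; apply: mul_assoc.
- by move=> *; apply: mul_one_l.
- by move=> *; apply: mul_one_r.
- move=> f Gf; have [g Gg fg] := mul_right_inverse Gf.
  have [h Gh gh] := mul_right_inverse Gg; exists g => //.
  suff -> : f = h by [].
  by rewrite -[f]mul_one_r -gh mul_assoc fg mul_one_l.
Qed.

(** * The composition group *)

(** When [g] has linear part the identity, [f \circ g - f] only involves values
    of [f] on lists shorter than [x]: the cutting into singletons contributes
    [f x], the others have fewer blocks. *)
Lemma comp_deg f g x : (forall t, (size t < size x)%N -> f t = 0) ->
  (forall b, g [:: b] = b) -> (f \circ g) x = f x.
Proof.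
move=> f0 g1; elim: x f f0 => [|b x IHx] f f0; first by rewrite comp_nil.
rewrite comp_cons; case: x IHx f0 => [|c x] IHx f0.
  by rewrite big_seq1 comp_nil g1.
rewrite (big_cuts_cons c x (fun u v => mult_comp (fun t => f (g (b :: u) :: t)) g v)).
rewrite g1 IHx => [|t tx]; last exact: f0.
rewrite big_seq big1 ?addr0 // => w /size_cuts wx.
rewrite mult_compE big_seq big1 // => p /segs_le_size pw; apply: f0.
by rewrite /= size_map !ltnS; apply: leq_trans wx.
Qed.

(** [psi] is the iteration for the fixed points of [q |-> I + q - q \circ f],
    that is, for the solutions of [q \circ f = I].  By [comp_deg] two successive
    approximations agree on one more size at each step, hence the value of the
    limit on [t] is reached at step [size t]. *)
Lemma comp_left_inverse1 f : Mult iota f -> (forall b, f [:: b] = b) ->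
  exists g, [/\ Mult iota g, g [::] = 0 & g \circ f = I].
Proof.
move=> Mf f1.
pose psi k := iter k (fun q t => I t + (q t - (q \circ f) t)) I.
have psiS k t : psi k.+1 t = I t + (psi k t - (psi k \circ f) t) by [].
have Mpsi k : Mult iota (psi k).
  elim: k => [|k IHk]; first exact: Mult_id.
  have -> : psi k.+1 = fun t => iota (-1) * (psi k \circ f) t + (iota 1 * I t + psi k t).
    apply/funext => t; rewrite psiS rmorphN1 mulN1r rmorph1 mul1r.
    by rewrite [RHS]addrC addrA.
  apply: Mult_lin; first exact: Mult_comp.
  by apply: Mult_lin; first exact: Mult_id.
have stableS k t : (size t <= k)%N -> psi k.+1 t = psi k t.
  elim: k t => [|k IHk] t tk.
    by case: t tk => // _; rewrite psiS /= comp_nil subrr addr0.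
  rewrite [LHS]psiS [RHS]psiS; congr (_ + _).
  (* The difference of two approximations, as a sum so that [comp_sum] applies. *)
  pose e u := \sum_(i <- [:: psi k.+1; fun v => iota (-1) * psi k v]) i u.
  have compe u : (e \circ f) u = (psi k.+1 \circ f) u - (psi k \circ f) u.
    rewrite comp_sum big_cons big_seq1; congr (_ + _).
    rewrite !mult_compE -sumrN; apply: eq_bigr => p _.
    by rewrite rmorphN1 mulN1r.
  have eE u : e u = psi k.+1 u - psi k u.
    by rewrite /e big_cons big_seq1 rmorphN1 mulN1r.
  have : e t = (e \circ f) t.
    rewrite comp_deg // => u ut; rewrite eE IHk ?subrr //.
    by rewrite -ltnS (leq_trans ut).
  rewrite eE compe => E; apply/eqP.
  by rewrite -subr_eq0 opprB [_ - psi k t]addrC addrACA E addrACA subrr addNr addr0.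
have stable k t : (size t <= k)%N -> psi k t = psi (size t) t.
  by move=> /subnK <-; elim: (_ - _)%N => [//|j <-]; rewrite addSn stableS // leq_addl.
exists (fun t => psi (size t) t); split => //.
  move=> s t a y z; rewrite !size_cat /=; exact: Mpsi.
apply/funext => x; set n := size x.
rewrite (@eq_comp_size _ _ (psi n)) => [|t tx]; last by rewrite [RHS]stable.
have := stableS n x (leqnn _); rewrite psiS => /eqP.
by rewrite addrCA -subr_eq0 addrAC subrr add0r subr_eq0 => /eqP.
Qed.

Lemma Gdif_comp f g : Gdif iota f -> Gdif iota g -> Gdif iota (f \circ g).
Proof.
move=> [Mf f0 bf] [Mg g0 bg]; split; first exact: Mult_comp.
  by rewrite comp_nil.
by apply: (eq_bij (bij_comp bf bg)) => b; rewrite comp_singleton.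
Qed.

(** [lin] is the inverse of the linear part of [f], so [lin \circ f] has linear
    part the identity, and a left inverse of it yields one of [f]. *)
Lemma comp_left_inverse f : Gdif iota f ->
  exists2 g, Gdif iota g & g \circ f = I.
Proof.
move=> [Mf f0 [L fK Lf]].
pose lin t : B := if t is [:: b] then L b else 0.
have Mlin : Mult iota lin.
  by apply: Mult_head => a b c; rewrite -{1}(Lf b) -{1}(Lf c) -(Mf [::] [::]) fK.
have [g [Mg g0 gL]] : exists g, [/\ Mult iota g, g [::] = 0 & g \circ (lin \circ f) = I].
  apply: comp_left_inverse1; first exact: Mult_comp.
  by move=> b; rewrite comp_singleton /= fK.
exists (g \circ lin); last by rewrite -comp_assoc.
have g1 b : g [:: b] = b.
  by have := congr1 (fun h => h [:: b]) gL; rewrite !comp_singleton /= fK.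
split; [exact: Mult_comp | by rewrite comp_nil |].
by exists (fun b => f [:: b]) => b; rewrite comp_singleton g1 /=.
Qed.

Lemma group_comp : group_on (Gdif iota) mult_comp I (comp_inv iota).
Proof.
apply: group_on_inverse_in.
- by split=> //; [exact: Mult_id | exists id].
- exact: Gdif_comp.
- by move=> f g h [Mf _ _] _ _; apply: comp_assoc.
- by move=> f [_ f0 _]; apply: comp_id_l.
- by move=> f [Mf _ _]; apply: comp_id_r.
- exact: comp_left_inverse.
Qed.

(** * The twisted laws *)

Lemma Ginv_comp f p : Ginv iota f -> Gdif iota p -> Ginv iota (f \circ p).
Proof.
move=> [Mf [c fc]] [Mp _ _]; split; first exact: Mult_comp.
by exists c; rewrite comp_nil.
Qed.

(** The linear part is [b |-> f_0 b g_0]; every [phi] of the twisted laws is of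
    this form. *)
Lemma Gdif_sandwich f g : Ginv iota f -> Ginv iota g -> Gdif iota (f ** I ** g).
Proof.
move=> [Mf [c [cf fc]]] [Mg [d [dg gd]]]; split.
- by do 2 apply: Mult_mul => //; exact: Mult_id.
- by rewrite !mul_nil mulr0 mul0r.
have E b : (f ** I ** g) [:: b] = f [::] * b * g [::].
  by rewrite mul_singleton !mul_nil mul_singleton /= !(mulr0, mul0r, add0r, addr0).
exists (fun b => c * b * d) => b; rewrite E !mulrA.
  by rewrite cf mul1r -mulrA gd mulr1.
by rewrite fc mul1r -mulrA dg mulr1.
Qed.

Let gM := group_mul.
Let gC := group_comp.

Lemma mult_inv_comp f p : Ginv iota f -> Gdif iota p ->
  mult_inv iota f \circ p = mult_inv iota (f \circ p).
Proof.
move=> Gf Dp; apply: (group_inv_uniq gM); try apply: Ginv_comp => //.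
  exact: (group_onV gM).
by rewrite -comp_mul (group_onVx gM) // comp_one.
Qed.

Lemma Ginv_one : Ginv iota mult_one.
Proof. exact: (group_on1 gM). Qed.

Lemma mult_inv_one : mult_inv iota mult_one = mult_one.
Proof.
by apply/esym/(group_inv_uniq gM); rewrite ?mul_one_l //; exact: Ginv_one.
Qed.

(** Stated for any product [dot] on which composition acts, to cover the
    multiplication and its opposite. *)
Lemma comp_twist (dot : (seq B -> B) -> (seq B -> B) -> seq B -> B)
    (phi : (seq B -> B) -> seq B -> B) :
  group_on (Ginv iota) dot mult_one (mult_inv iota) ->
  (forall F H p, mult_comp (dot F H) p = dot (F \circ p) (H \circ p)) ->
  (forall F, Ginv iota F -> Gdif iota (phi F)) ->
  phi mult_one = I ->
  (forall F H, Ginv iota F -> Ginv iota H ->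
     phi F \circ phi H = phi (dot H (F \circ phi H))) ->
  group_on (Ginv iota) (fun F H => dot H (F \circ phi H)) mult_one
    (fun F => mult_inv iota F \circ comp_inv iota (phi F)).
Proof.
move=> gdot comp_dot phiD phi1 phiM.
apply: (group_on_twist gdot gC) => //.
- exact: Ginv_comp.
- by move=> p _; apply: comp_one.
- by move=> F p q [MF _] _ _; apply: comp_assoc.
- by move=> F [MF _]; apply: comp_id_r.
Qed.

Lemma comp_id_Gdif p : Gdif iota p -> I \circ p = p.
Proof. exact: (group_on1x gC). Qed.

Lemma group_lstar : group_on (Ginv iota) lstar mult_one (S_lstar iota).
Proof.
have D F : Ginv iota F -> Gdif iota (I ** F).
  by move=> GF; rewrite -[I]mul_one_l; apply: Gdif_sandwich => //; exact: Ginv_one.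
apply: (comp_twist gM (@comp_mul B) (phi := fun F => I ** F)) => // [|F H GF GH].
  exact: mul_one_r.
by rewrite comp_mul (comp_id_Gdif (D _ GH)) mul_assoc.
Qed.

Lemma group_rstar : group_on (Ginv iota) rstar mult_one (S_rstar iota).
Proof.
have D F : Ginv iota F -> Gdif iota (F ** I).
  by move=> GF; rewrite -[_ ** I]mul_one_r; apply: Gdif_sandwich => //; exact: Ginv_one.
apply: (comp_twist (group_on_flip gM) (fun F H p => comp_mul H F p)
  (phi := fun F => F ** I)) => // [|F H GF GH].
  exact: mul_one_l.
by rewrite comp_mul (comp_id_Gdif (D _ GH)) mul_assoc.
Qed.

Lemma group_bullet : group_on (Ginv iota) (bullet iota) mult_one (S_bullet iota).
Proof.
have D F : Ginv iota F -> Gdif iota (mult_inv iota F ** I ** F).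
  by move=> GF; apply: Gdif_sandwich => //; apply: (group_onV gM).
apply: (comp_twist gM (@comp_mul B) (phi := fun F => mult_inv iota F ** I ** F)) => // [|F H GF GH].
  by rewrite mult_inv_one mul_one_l mul_one_r.
have GFp := Ginv_comp GF (D _ GH).
rewrite !comp_mul (comp_id_Gdif (D _ GH)) (mult_inv_comp GF (D _ GH)) (group_inv_op gM) //.
by rewrite !mul_assoc.
Qed.

Lemma group_bullet' : group_on (Ginv iota) (bullet' iota) mult_one (S_bullet' iota).
Proof.
have D F : Ginv iota F -> Gdif iota (F ** I ** mult_inv iota F).
  by move=> GF; apply: Gdif_sandwich => //; apply: (group_onV gM).
apply: (comp_twist (group_on_flip gM) (fun F H p => comp_mul H F p)
  (phi := fun F => F ** I ** mult_inv iota F)) => // [|F H GF GH].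
  by rewrite mult_inv_one mul_one_l mul_one_r.
have GFp := Ginv_comp GF (D _ GH).
rewrite !comp_mul (comp_id_Gdif (D _ GH)) (mult_inv_comp GF (D _ GH)) (group_inv_op gM) //.
by rewrite !mul_assoc.
Qed.

End Multilinear.

Theorem proposition3p16 (K : fieldType) (charK0 : [pchar K] =i pred0)
    (B : pzRingType) (iota : {rmorphism K -> B})
    (iota_central : forall (a : K) (x : B), iota a * x = x * iota a) :
  [/\ group_on (Ginv iota) mult_mul mult_one (sigma iota),
      group_on (Ginv iota) lstar mult_one (S_lstar iota),
      group_on (Ginv iota) rstar mult_one (S_rstar iota),
      group_on (Ginv iota) (bullet iota) mult_one (S_bullet iota) &
      group_on (Ginv iota) (bullet' iota) mult_one (S_bullet' iota)]
  /\
  [/\ {in Ginv iota, involutive (sigma iota)},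
      {in Ginv iota, involutive (S_lstar iota)},
      {in Ginv iota, involutive (S_rstar iota)},
      {in Ginv iota, involutive (S_bullet iota)} &
      {in Ginv iota, involutive (S_bullet' iota)}].
Proof.
have g1 := group_mul iota_central.
have g2 := group_lstar iota_central.
have g3 := group_rstar iota_central.
have g4 := group_bullet iota_central.
have g5 := group_bullet' iota_central.
split; first by split.
by split; [exact: group_invK g1 | exact: group_invK g2 | exact: group_invK g3
  | exact: group_invK g4 | exact: group_invK g5].
Qed.
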